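(* For every finite signed graph $(G,\sigma)$ with no positive bridge, $$\Phi_c(G,\sigma)=\min\Big\{\frac pq:\ (G,\sigma)\text{ admits a circular }\frac pq\text{-flow},\ p,q\in\mathbb{Z},\ 1\le 2q\le p\le 2|E(G)|\Big\}.$$ In particular, $\Phi_c(G,\sigma)$ is a rational number.
   Context: Graphs may have multiple edges but no loops; a signed graph $(G,\sigma)$ has $\sigma:E(G)\to\{+,-\}$; a positive bridge is a bridge of $G$ whose sign is $+$. For an orientation $D$ and $f:E(G)\to\mathbb{R}$, $\partial_Df(v)$ is the sum of $f$ over out-arcs at $v$ minus the sum over in-arcs. A circular $r$-flow ($r\ge2$) is a pair $(D,f)$ with $D$ an orientation of $G$ and $f:E(G)\to(-r,r)$ such that $|f(e)|\in[1,r-1]$ for positive edges, $|f(e)|\in[0,\frac r2-1]\cup[\frac r2+1,r)$ for negative edges, and $\partial_Df(v)=0$ at every vertex. The circular flow index $\Phi_c(G,\sigma)$ is the infimum of $r$ for which $(G,\sigma)$ admits a circular $r$-flow. *)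

(* Defs.v *)
From HB Require Import structures.
From mathcomp Require Import all_boot all_order all_algebra.
From mathcomp Require Import boolp classical_sets reals.

Set Implicit Arguments.
Unset Strict Implicit.
Unset Printing Implicit Defensive.

Import Order.TTheory GRing.Theory Num.Theory.
Local Open Scope ring_scope.

(* Finite multigraphs without loops: distinct edges may have the same ends. *)
Record multigraph := Multigraph {
  vertex : finType;
  edge : finType;
  ends : edge -> {set vertex};
  card_ends : forall e, #|ends e| = 2%N
}.

Variant sign := Pos | Neg.

(* Adjacency in the graph obtained from G by deleting the edge e. *)
Definition adj_del (G : multigraph) (e : edge G) : rel (vertex G) :=
  fun x y => [exists e' : edge G, (e' != e) && (ends e' == [set x; y]%SET)].

(* A bridge is an edge that separates its two ends. *)
Definition bridge (G : multigraph) (e : edge G) : Prop :=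
  exists x y : vertex G,
    ends e = [set x; y]%SET /\ ~~ connect (adj_del e) x y.

Definition positive_bridge (G : multigraph) (sigma : edge G -> sign)
    (e : edge G) : Prop :=
  bridge e /\ sigma e = Pos.

Record orientation (G : multigraph) := Orientation {
  tail : edge G -> vertex G;
  head : edge G -> vertex G;
  orientation_ends : forall e, ends e = [set tail e; head e]%SET
}.

Section CircularFlow.
Variables (R : realType) (G : multigraph).
Implicit Types (sigma : edge G -> sign) (D : orientation G) (f : edge G -> R).

Definition boundary D f (v : vertex G) : R :=
  \sum_(e | tail D e == v) f e - \sum_(e | head D e == v) f e.

Definition circular_flow sigma (r : R) D f : Prop :=
  [/\ forall e, - r < f e < r,
      forall e, sigma e = Pos -> 1 <= `|f e| <= r - 1,
      forall e, sigma e = Neg ->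
        (0 <= `|f e| <= r / 2 - 1) \/ (r / 2 + 1 <= `|f e| < r)
    & forall v, boundary D f v = 0].

Definition admits_circular_flow sigma (r : R) : Prop :=
  2 <= r /\ exists D f, circular_flow sigma r D f.

Definition circular_flow_index sigma : R :=
  inf (fun r : R => admits_circular_flow sigma r).

Definition bounded_flow_fractions sigma : set R :=
  fun r => exists p q : int,
    [/\ 1 <= 2 * q, 2 * q <= p, p <= 2 * #|edge G|%:Z,
        r = p%:~R / q%:~R & admits_circular_flow sigma (p%:~R / q%:~R)].

End CircularFlow.

Arguments circular_flow_index R {G} sigma.
Arguments bounded_flow_fractions R {G} sigma _.

Definition is_minimum (R : realType) (S : set R) (m : R) : Prop :=
  S m /\ lbound S m.

(* Main.v *)
Require Import Defs.
From HB Require Import structures.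
From mathcomp Require Import all_boot all_order all_algebra.
From mathcomp Require Import boolp classical_sets reals.
From mathcomp Require Import topology normedtype derive lra.

Set Implicit Arguments.
Unset Strict Implicit.
Unset Printing Implicit Defensive.

Import Order.TTheory GRing.Theory Num.Theory.
Import numFieldNormedType.Exports.
Local Open Scope ring_scope.

(** Allow negative edges to carry the value r itself; then the pairs (r, f) form
    a closed set, so by compactness there is a smallest r >= 2 with such a
    closed flow.  If r > 2, orient the graph so that f >= 0.  Either residual
    paths let us move f strictly below all upper bounds, and r could be
    decreased, or some cut has all out-edges at their upper bound and all
    in-edges at their lower bound; conservation across that cut is a linear
    equation forcing r = p / q with p <= 2|E|.  A closed r-flow becomes a
    circular r-flow by subtracting r along directed cycles through the edges of
    value r.  Some flow exists because every positive edge lies on a cycle, and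
    a suitable combination of these cycles is nonzero on all positive edges. *)

Local Notation head := Defs.head.

(** * Boundaries *)

Section Boundary.
Variables (R : realType) (G : multigraph).
Implicit Types (D : orientation G) (f g : edge G -> R) (v : vertex G).

Lemma boundaryE D f v :
  boundary D f v = \sum_e f e * ((tail D e == v)%:R - (head D e == v)%:R).
Proof.
rewrite /boundary big_mkcond [X in _ - X]big_mkcond -sumrB /=.
apply: eq_bigr => e _; rewrite mulrBr.
by do 2!case: eqP => _; rewrite ?mulr1 ?mulr0.
Qed.

Lemma boundaryD D f g v :
  boundary D (fun e => f e + g e) v = boundary D f v + boundary D g v.
Proof.
by rewrite !boundaryE -big_split; apply: eq_bigr => e _; rewrite mulrDl.
Qed.

Lemma boundaryZ D (c : R) f v :
  boundary D (fun e => c * f e) v = c * boundary D f v.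
Proof.
by rewrite !boundaryE mulr_sumr; apply: eq_bigr => e _; rewrite mulrA.
Qed.

Lemma boundary0 D v : boundary D (fun=> 0 : R) v = 0.
Proof. by rewrite boundaryE big1 // => e _; rewrite mul0r. Qed.

Lemma boundary_sum (I : finType) D (F : I -> edge G -> R) v :
  boundary D (fun e => \sum_i F i e) v = \sum_i boundary D (F i) v.
Proof.
rewrite boundaryE; under [RHS]eq_bigr do rewrite boundaryE.
by rewrite exchange_big; apply: eq_bigr => e _; rewrite mulr_suml.
Qed.

Lemma boundary_edge D e0 v :
  boundary D (fun e => (e == e0)%:R : R) v
  = (tail D e0 == v)%:R - (head D e0 == v)%:R.
Proof.
rewrite boundaryE (bigD1 e0) //= eqxx mul1r big1 ?addr0 // => e /negPf ->.
by rewrite mul0r.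
Qed.

Lemma eq_boundary D f g v : f =1 g -> boundary D f v = boundary D g v.
Proof. by move=> fg; rewrite !boundaryE; apply: eq_bigr => e _; rewrite fg. Qed.

(** In the sum of the boundaries over [X], edges inside [X] cancel and edges across it count with
    their sign. *)
Lemma circulation_cut D f (X : {set vertex G}) :
  (forall v, boundary D f v = 0) ->
  \sum_(e | (tail D e \in X) && (head D e \notin X)) f e
  = \sum_(e | (tail D e \notin X) && (head D e \in X)) f e.
Proof.
move=> circ; have : \sum_(v in X) boundary D f v = 0 by rewrite big1.
under eq_bigr do rewrite boundaryE.
rewrite exchange_big /= => sum0; apply/eqP; rewrite -subr_eq0; apply/eqP.
apply: etrans sum0.
rewrite big_mkcond [X in _ - X]big_mkcond -sumrB /=; apply: eq_bigr => e _.
have inX w : \sum_(v in X) (w == v)%:R = (w \in X)%:R :> R.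
  have [wX|wX] := boolP (w \in X); last first.
    by rewrite big1 // => v vX; case: eqP => // wv; rewrite wv vX in wX.
  rewrite (bigD1 w) //= eqxx big1 ?addr0 // => v /andP[_].
  by rewrite eq_sym => /negPf->.
rewrite -mulr_sumr sumrB !inX.
by case: (_ \in X); case: (_ \in X);
  rewrite /= ?subrr ?subr0 ?sub0r ?mulr0 ?mulr1 ?mulrN1.
Qed.

Lemma orientation_exists : exists D : orientation G, True.
Proof.
have ex_ends (e : edge G) :
    exists z : vertex G * vertex G, ends e = [set z.1; z.2]%SET.
  have /eqP/cards2P[x [y [_ xy]]] := card_ends e.
  by exists (x, y).
have [t tP] := boolp.choice ex_ends.
by exists (Orientation tP).
Qed.

Lemma set2_inj (T : finType) (a b c d : T) :
  [set a; b]%SET = [set c; d]%SET ->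
  (a = c /\ b = d) \/ (a = d /\ b = c).
Proof.
move=> E.
have: a \in [set c; d]%SET by rewrite -E !inE eqxx.
have: b \in [set c; d]%SET by rewrite -E !inE eqxx orbT.
have: c \in [set a; b]%SET by rewrite E !inE eqxx.
have: d \in [set a; b]%SET by rewrite E !inE eqxx orbT.
by rewrite !inE => /orP[]/eqP ? /orP[]/eqP ? /orP[]/eqP ? /orP[]/eqP ?;
  subst; auto.
Qed.

(** Negating [f] where the two orientations differ compensates for the reversal. *)
Lemma boundary_reorient D D' f :
  exists2 g, forall e, `|g e| = `|f e|
           & forall v, boundary D' g v = boundary D f v.
Proof.
exists (fun e => if tail D' e == tail D e then f e else - f e) => [e|v].
  by case: ifP; rewrite ?normrN.
rewrite !boundaryE; apply: eq_bigr => e _.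
have := orientation_ends D' e; rewrite (orientation_ends D) => /set2_inj.
case=> [[-> ->]|[-> ->]]; first by rewrite eqxx.
case: eqP => [->|_]; first by [].
by rewrite mulNr -mulrN opprB.
Qed.

(** Reversing the edges of negative value allows flows to be taken nonnegative. *)
Lemma boundary_norm D f :
  exists D', forall v, boundary D' (fun e => `|f e|) v = boundary D f v.
Proof.
pose t e := if 0 <= f e then tail D e else head D e.
pose h e := if 0 <= f e then head D e else tail D e.
have thP e : ends e = [set t e; h e]%SET.
  rewrite (orientation_ends D) /t /h; case: ifP => // _.
  by rewrite finset.setUC.
exists (Orientation thP) => v; rewrite !boundaryE; apply: eq_bigr => e _.
rewrite /= /t /h; case: ifPn => [/ger0_norm -> //|].
by rewrite -ltNge => /ltr0_norm ->; rewrite mulNr -mulrN opprB.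
Qed.

(** Boundaries telescope along a path. The class [C] is left abstract to serve both for functions
    vanishing at a given edge and for feasible directions. *)
Lemma connect_boundary D (r : rel (vertex G)) (C : (edge G -> R) -> Prop) :
  C (fun=> 0) ->
  (forall f g, C f -> C g -> C (fun e => f e + g e)) ->
  (forall a b, r a b -> exists2 g, C g &
     forall v, boundary D g v = (a == v)%:R - (b == v)%:R) ->
  forall a b, connect r a b -> exists2 g, C g &
     forall v, boundary D g v = (a == v)%:R - (b == v)%:R.
Proof.
move=> C0 CD Cr a b /connectP[p + ->] {b}; elim: p a => [|b p IH] a /=.
  by exists (fun=> 0) => // v; rewrite boundary0 subrr.
move=> /andP[/Cr[g Cg gP] /IH[h Ch hP]]; exists (fun e => g e + h e).
  exact: CD.
by move=> v; rewrite boundaryD gP hP addrA subrK.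
Qed.

(** A simple path repeats no edge, so an indicator function suffices. The clause on [belast] shows
    that an edge prepended to the path is new: its tail does not recur. *)
Lemma path_edge_set D (P : pred (edge G)) x p :
  path (fun a b => [exists e, [&& tail D e == a, head D e == b & P e]]) x p ->
  uniq (x :: p) ->
  exists2 S : {set edge G},
    forall e, e \in S -> P e /\ tail D e \in belast x p
    & forall v, boundary D (fun e => (e \in S)%:R : R) v
                = (x == v)%:R - (last x p == v)%:R.
Proof.
elim: p x => [|y p IH] x /=.
  move=> _ _; exists finset.set0 => [e|v]; first by rewrite inE.
  rewrite subrr -[RHS](boundary0 D v).
  by apply: eq_boundary => e; rewrite inE.
move=> /andP[/existsP[e0 /and3P[/eqP te0 /eqP he0 Pe0]] pth].
move=> /andP[xp up]; have [S SP bS] := IH y pth up.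
have e0S : e0 \notin S.
  apply/negP => /SP[_]; rewrite te0 => /mem_belast xyp.
  by rewrite xyp in xp.
exists (e0 |: S)%SET => [e|v].
  rewrite !inE => /orP[/eqP->|/SP[? tp]]; first by rewrite te0 eqxx.
  by rewrite tp orbT.
rewrite (_ : _ - _ = ((x == v)%:R - (y == v)%:R)
   + ((y == v)%:R - (last y p == v)%:R)); last by rewrite addrA subrK.
rewrite -bS -te0 -he0 -(boundary_edge D e0) -boundaryD.
apply: eq_boundary => e; rewrite !inE.
by case: eqP => [->|_]; rewrite /= ?add0r // (negPf e0S) addr0.
Qed.

End Boundary.

(** * Closed flows *)

Section ClosedFlow.
Variables (R : realType) (G : multigraph) (sigma : edge G -> sign).
Implicit Types (D : orientation G) (f : edge G -> R).

(* Unlike in a circular r-flow, a negative edge may carry the value r itself: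
   this makes the set of pairs (r, f) closed. *)
Definition closed_value (s : sign) (r x : R) : Prop :=
  match s with
  | Pos => 1 <= x <= r - 1
  | Neg => 0 <= x <= r / 2 - 1 \/ r / 2 + 1 <= x <= r
  end.

Definition closed_flow (r : R) D f : Prop :=
  (forall e, closed_value (sigma e) r `|f e|) /\
  (forall v, boundary D f v = 0).

Lemma closed_value_le s r x : 2 <= r -> closed_value s r x -> x <= r.
Proof. by case: s => /=; [lra | move=> ? []; lra]. Qed.

(** The reflection of [x] to [r - x] preserves the interval of a positive edge and swaps the two
    intervals of a negative one. *)
Lemma closed_value_sub s r x :
  0 < x -> x <= r -> closed_value s r x -> closed_value s r (r - x).
Proof.
case: s => /= x0 xr; first by lra.
by case=> ?; [right | left]; lra.
Qed.

Lemma circular_flow_closed r D f :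
  circular_flow sigma r D f -> closed_flow r D f.
Proof.
move=> [_ fpos fneg f0]; split=> // e.
case E: (sigma e) => /=; first exact: fpos.
by case: (fneg e E) => [?|/andP[? /ltW ?]]; [left | right; apply/andP].
Qed.

Lemma closed_flow_circular r D f :
  closed_flow r D f -> (forall e, `|f e| < r) -> circular_flow sigma r D f.
Proof.
move=> [fv f0] fr; split=> // e; first by rewrite -ltr_norml.
  by move=> E; have := fv e; rewrite E.
by move=> E; have := fv e; rewrite E /= => -[|/andP[? _]];
  [left | right; apply/andP].
Qed.

(** Allows the radius to be minimised over one fixed orientation. *)
Lemma closed_flow_reorient r D D' f :
  closed_flow r D f -> exists g, closed_flow r D' g.
Proof.
move=> [fv f0]; have [g gf gb] := boundary_reorient D D' f.
by exists g; split=> [e|v]; rewrite ?gf ?gb.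
Qed.

(* Subtracting r along a directed cycle on which the flow is positive keeps
   all values admissible and clears the edges of the cycle carrying r. *)
Lemma circular_flow_of_closed r D f :
  2 <= r -> closed_flow r D f -> exists D' f', circular_flow sigma r D' f'.
Proof.
move=> r2; have r0 : 0 < r by lra.
have [n] := ubnP #|[set e | `|f e| == r]%SET|.
elim: n => // n IH in D f *; rewrite ltnS => fn [fv f0].
have [/forallP small|] := boolP [forall e, `|f e| != r].
  exists D, f; apply: closed_flow_circular => // e.
  by rewrite lt_neqAle small; apply: closed_value_le (fv e).
rewrite negb_forall => /existsP[e0]; rewrite negbK => fe0.
have [D' bD'] := boundary_norm D f; pose g e := `|f e|.
have g0 v : boundary D' g v = 0 by rewrite bD'.
have gr e : g e <= r by apply: closed_value_le (fv e).
pose step a b := [exists e, [&& tail D' e == a, head D' e == b & 0 < g e]].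
(* Otherwise the vertices reachable from [head D' e0] along positive edges would receive at least
   [r] through [e0] and send nothing out. *)
have /connectP[p0 pth0 lastp0] : connect step (head D' e0) (tail D' e0).
  apply/negPn/negP => nconn.
  have := circulation_cut [set v | connect step (head D' e0) v]%SET g0.
  rewrite big1 => [|e]; last first.
    rewrite !inE => /andP[ct nh]; apply/eqP; rewrite eq_le normr_ge0 andbT.
    rewrite leNgt; apply/negP => ge.
    case/negP: nh; apply: (connect_trans ct); apply: connect1.
    by apply/existsP; exists e; rewrite !eqxx.
  rewrite (bigD1 e0) /=; last by rewrite !inE nconn connect0.
  rewrite /g (eqP fe0) => /esym/eqP; apply/negP; rewrite gt_eqF //.
  by rewrite ltr_pwDl // sumr_ge0.
(* An empty path would make [e0] a loop. *)
move: pth0 lastp0; have [-> //|] := eqVneq p0 [::].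
  move=> _ /= te0; have := card_ends e0; rewrite (orientation_ends D') te0.
  by rewrite finset.setUid cards1.
move=> _ pth0; case/shortenP: pth0 => p pth up _ lastp.
have [S SP bS] := path_edge_set R pth up.
have e0S : e0 \notin S.
  apply/negP => /SP[_]; rewrite lastp.
  by move: up; rewrite lastI rcons_uniq => /andP[/negPf->].
pose h e := g e - r * (e \in e0 |: S)%SET%:R.
have hgr e : (e \in e0 |: S)%SET -> `|h e| = r - g e.
  by move=> eS; rewrite /h eS mulr1 distrC ger0_norm // subr_ge0.
have hg e : (e \notin e0 |: S)%SET -> `|h e| = g e.
  by move=> /negPf eS; rewrite /h eS mulr0 subr0 normr_id.
have gS e : (e \in e0 |: S)%SET -> 0 < g e.
  by rewrite !inE => /orP[/eqP->|/SP[]//]; rewrite /g (eqP fe0).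
apply: (IH D' h).
  (* The value at [e0] becomes 0, and no edge newly reaches [r] because [g] is positive on the
     cycle. *)
  apply: leq_trans fn; apply: proper_card; apply/properP; split; last first.
    exists e0; rewrite !inE ?fe0 // hgr ?inE ?eqxx // /g (eqP fe0) subrr.
    by rewrite lt_eqF.
  apply/fintype.subsetP => e; rewrite !inE.
  have [eS|eS] := boolP (e \in e0 |: S)%SET; last by rewrite hg.
  by rewrite hgr // subr_eq -subr_eq0 opprD addNKr oppr_eq0 gt_eqF // gS.
split=> [e|v].
  have [eS|eS] := boolP (e \in e0 |: S)%SET; last by rewrite hg.
  by rewrite hgr //; apply: closed_value_sub; rewrite ?gS.
rewrite (@eq_boundary _ _ _ _ (fun e => g e
  + (- r) * ((e == e0)%:R + (e \in S)%:R))) => [|e]; last first.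
  rewrite /h !inE mulNr; congr (_ - _ * _).
  by case: eqP => [->|_]; rewrite ?(negPf e0S) /= ?addr0 ?add0r.
rewrite boundaryD boundaryZ boundaryD boundary_edge bS g0 -lastp.
by rewrite addrA subrK subrr mulr0 addr0.
Qed.

(** Each edge of [P] lies on a cycle. The cycles are added one by one, with a multiplier that keeps
    earlier nonzero values nonzero. *)
Lemma circulation_through D (P : pred (edge G)) :
  (forall e, P e -> ~ bridge e) ->
  exists2 f : edge G -> R, forall e, P e -> f e != 0
                         & forall v, boundary D f v = 0.
Proof.
move=> nb.
have cycle e0 : exists c : edge G -> R, P e0 ->
    c e0 != 0 /\ forall v, boundary D c v = 0.
  have [/nb nbe0|_] := boolP (P e0); last by exists (fun=> 0).
  have : connect (adj_del e0) (tail D e0) (head D e0).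
    apply/negPn/negP => nc; apply: nbe0; exists (tail D e0), (head D e0).
    by split=> //; apply: orientation_ends.
  move=> /(@connect_boundary R _ D _ (fun g => g e0 = 0)) [].
  - by [].
  - by move=> f g -> ->; rewrite addr0.
  - move=> a b /existsP[e /andP[ne /eqP]]; rewrite (orientation_ends D).
    move=> /set2_inj[[ta hb]|[tb ha]].
      exists (fun e' => (e' == e)%:R) => [|v].
        by rewrite eq_sym (negPf ne).
      by rewrite boundary_edge ta hb.
    exists (fun e' => (-1) * (e' == e)%:R) => [|v].
      by rewrite eq_sym (negPf ne) mulr0.
    by rewrite boundaryZ boundary_edge tb ha mulN1r opprB.
  (* The path avoiding [e0], closed up by [e0] taken backwards, has value -1 at [e0]. *)
  move=> g ge0 bg; exists (fun e => g e + (-1) * (e == e0)%:R) => _; split.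
    by rewrite ge0 eqxx mulr1 add0r oppr_eq0 oner_eq0.
  by move=> v; rewrite boundaryD boundaryZ boundary_edge bg mulN1r subrr.
have [c cP] := boolp.choice cycle.
suff [f fP f0] : exists2 f : edge G -> R, forall e, e \in enum P -> f e != 0
    & forall v, boundary D f v = 0.
  by exists f => // e Pe; apply: fP; rewrite mem_enum.
have : {in enum P, forall e, P e} by move=> e; rewrite mem_enum.
elim: (enum P) => [|e0 s IH] sP.
  by exists (fun=> 0) => // v; rewrite boundary0.
have [e es|f fP f0] := IH; first by apply: sP; rewrite inE es orbT.
have [fe0|fe0] := eqVneq (f e0) 0; last first.
  by exists f => // e; rewrite inE => /orP[/eqP->|/fP].
have [ce0 c0] := cP e0 (sP e0 (mem_head _ _)).
(* M is large enough for M f to dominate c e0 wherever f is nonzero. *)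
pose M := 1 + \sum_e `|c e0 e| / `|f e|.
exists (fun e => M * f e + c e0 e) => [e|v]; last first.
  by rewrite boundaryD boundaryZ f0 c0 mulr0 addr0.
rewrite inE => /orP[/eqP->|/fP fe]; first by rewrite fe0 mulr0 add0r.
rewrite addr_eq0; apply: contraNneq fe => /(congr1 Num.norm).
rewrite normrN normrM => Mf; apply/negPn/negP => fe.
have fe_gt0 : 0 < `|f e| by rewrite normr_gt0.
have : `|c e0 e| / `|f e| < M.
  rewrite /M (bigD1 e) //= addrCA ltrDl ltr_pwDl // sumr_ge0 // => e' _.
  by rewrite divr_ge0.
rewrite ltr_pdivrMr // -Mf ltNge => /negP; apply.
by rewrite ler_pM2r // ler_norm.
Qed.

Lemma closed_flow_exists D :
  (forall e, ~ positive_bridge sigma e) ->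
  exists (r : R) f, 2 <= r /\ closed_flow r D f.
Proof.
move=> npb; pose P e := if sigma e is Pos then true else false.
have [f fP f0] : exists2 f : edge G -> R, forall e, P e -> f e != 0
    & forall v, boundary D f v = 0.
  apply: circulation_through => e; rewrite /P; case E: (sigma e) => // _ be.
  exact: (npb e).
(* The factor [c] is at least the inverse of each nonzero absolute value; zero values add nothing,
   as the inverse of 0 is 0. *)
pose c := \sum_e `|f e|^-1; pose g e := c * f e; pose s := \sum_e `|g e|.
have c0 : 0 <= c by rewrite sumr_ge0 // => e _; rewrite invr_ge0.
have gs e : `|g e| <= s by rewrite /s (bigD1 e) //= lerDl sumr_ge0.
have s0 : 0 <= s by rewrite sumr_ge0.
(* With this radius [r / 2 - 1] equals [s], so every value lies below the gap of a negative edge. *)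
exists (2 * s + 2), g; split; first by lra.
split=> [e|v]; last by rewrite boundaryZ f0 mulr0.
have ge := gs e; have ge0 := normr_ge0 (g e).
case E: (sigma e) => /=; last by left; lra.
have fe : 0 < `|f e| by rewrite normr_gt0; apply: fP; rewrite /P E.
suff : 1 <= `|g e| by lra.
rewrite /g normrM (ger0_norm c0) -ler_pdivrMr // mul1r /c (bigD1 e) //= lerDl.
by rewrite sumr_ge0 // => e' _; rewrite invr_ge0.
Qed.

End ClosedFlow.

(** * Compactness and the smallest radius *)

Lemma closed_le_continuous (R : realType) (T : topologicalType) (F H : T -> R) :
  continuous F -> continuous H -> closed [set v | F v <= H v]%classic.
Proof.
move=> cF cH.
rewrite (_ : mkset _ = (fun v => H v - F v) @^-1` [set x | 0 <= x])%classic.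
  apply: preimage_closed; last exact: closed_ge.
  by move=> v _; apply: cvgB; [exact: cH | exact: cF].
by apply/funext => v /=; rewrite subr_ge0.
Qed.

Lemma affine_continuous (R : realType) (T : topologicalType) (F : T -> R)
    (a b : R) :
  continuous F -> continuous (fun v => F v * a + b).
Proof.
move=> cF v; apply: cvgD; last exact: cvg_cst.
by apply: cvgM; [exact: cF | exact: cvg_cst].
Qed.

Section MinimalRadius.
Variables (R : realType) (G : multigraph) (sigma : edge G -> sign).
Variable D : orientation G.

(** Coordinate 0 holds the radius and the others the edge values, so a radius and a flow form one
    point of a finite-dimensional space. *)
Let vec := 'rV[R]_#|edge G|.+1.
Let radius (x : vec) : R := x ord0 ord0.
Let value (x : vec) (e : edge G) : R := x ord0 (lift ord0 (enum_rank e)).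

Let radius_continuous : continuous radius.
Proof. exact: coord_continuous. Qed.

Let norm_value_continuous e : continuous (fun x => `|value x e|).
Proof.
move=> x.
by apply: (@continuous_comp _ _ _ (fun x : vec => value x e) Num.norm);
  [exact: coord_continuous | exact: norm_continuous].
Qed.

Let affine_radius_continuous (a b : R) : continuous (fun x => radius x * a + b).
Proof. exact: affine_continuous. Qed.

Let boundary_continuous v : continuous (fun x => boundary D (value x) v).
Proof.
rewrite (_ : (fun x => _) = fun x => \sum_e
    value x e * ((tail D e == v)%:R - (head D e == v)%:R)).
  apply: continuous_big => [|e _]; first exact: add_continuous.
  under eq_fun do rewrite -[_ * _]addr0.
  exact/affine_continuous/coord_continuous.
by apply/funext => x; rewrite boundaryE.
Qed.

Let closed_valueS s e :
  closed [set x | closed_value s (radius x) `|value x e|]%classic.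
Proof.
have le1 a b : closed [set x | `|value x e| <= radius x * a + b]%classic.
  exact: closed_le_continuous.
have le2 a b : closed [set x | radius x * a + b <= `|value x e|]%classic.
  exact: closed_le_continuous.
case: s => /=.
  have := closedI (le2 0 1) (le1 1 (-1)); congr closed; apply/seteqP.
  by split=> x /=; rewrite mulr0 add0r mulr1 => /andP.
have := closedU (closedI (le2 0 0) (le1 2^-1 (-1)))
                (closedI (le2 2^-1 1) (le1 1 0)).
congr closed; apply/seteqP.
by split=> x /=; rewrite mulr0 addr0 mulr1 addr0 => -[] /andP; auto.
Qed.

(** Flows of radius at most that of a known flow form a closed subset of a box, as values are
    bounded by the radius; the continuous radius attains its minimum there. *)
Lemma minimal_closed_flow :
  (exists (r : R) f, 2 <= r /\ closed_flow sigma r D f) ->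
  exists (r : R) f, [/\ 2 <= r, closed_flow sigma r D f
    & forall r' f', 2 <= r' -> closed_flow sigma r' D f' -> r <= r'].
Proof.
move=> [r1 [f1 [r1_ge2 f1P]]].
pose K := [set x : vec | [/\ 2 <= radius x, radius x <= r1
  & closed_flow sigma (radius x) D (value x)]]%classic.
pose mkvec (r : R) (f : edge G -> R) : vec :=
  \row_i (if unlift ord0 i is Some j then f (enum_val j) else r).
have radiusE r f : radius (mkvec r f) = r by rewrite /radius mxE unlift_none.
have valueE r f : value (mkvec r f) = f.
  by apply/funext => e; rewrite /value mxE liftK enum_rankK.
have inK r f : 2 <= r -> r <= r1 -> closed_flow sigma r D f -> K (mkvec r f).
  by move=> *; rewrite /K /= radiusE valueE.
have closedK : closed K.
  pose vals := (\bigcap_(e in [set: edge G])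
    [set x | closed_value (sigma e) (radius x) `|value x e|])%classic.
  pose bnds := (\bigcap_(v in [set: vertex G])
    [set x | boundary D (value x) v = 0])%classic.
  have : closed ([set x | (2 : R) <= radius x] `&` [set x | radius x <= r1]
                 `&` (vals `&` bnds))%classic.
    apply: closedI; apply: closedI.
    - apply: (@closed_le_continuous R vec (fun=> 2) radius) => //.
      exact: cst_continuous.
    - apply: (@closed_le_continuous R vec radius (fun=> r1)) => //.
      exact: cst_continuous.
    - by apply: closed_bigI => e _; apply: closed_valueS.
    - apply: closed_bigI => v _.
      apply: (@preimage_closed _ _ (fun x => boundary D (value x) v)
        [set 0]%classic).
        by move=> x _; apply: boundary_continuous.
      exact: closed_eq.
  congr closed; apply/seteqP; split=> x /=.
    by move=> [[? ?] [vx bx]]; split=> //; split=> *; [apply: vx | apply: bx].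
  by move=> [? ? [vx bx]]; split=> //; split=> i _ /=.
have compactK : compact K.
  apply: (subclosed_compact closedK
    (@rV_compact R _ (fun=> `[- r1, r1]%classic) _)).
    by move=> i; apply: segment_compact.
  move=> x [r2 rr1 [vx _]] i /=; rewrite in_itv /= -ler_norml.
  case: (unliftP ord0 i) => [j ->|->]; last first.
    by rewrite ger0_norm //; apply: le_trans r2.
  apply: le_trans rr1; have := closed_value_le r2 (vx (enum_val j)).
  by rewrite /value enum_valK.
have [] := @compact_EVT_min _ _ radius K _ compactK.
- by exists (mkvec r1 f1); apply: inK.
- exact: continuous_subspaceT.
move=> x; rewrite inE => -[r2 rr1 xP] xmin.
exists (radius x), (value x); split=> // r' f' r'2 f'P.
have [r'r1|/ltW] := leP r' r1; last exact: le_trans.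
by rewrite -(radiusE r' f'); apply: xmin; rewrite inE; apply: inK.
Qed.

End MinimalRadius.

(** * Tight cuts *)

Lemma near0_forall (R : realType) (I : finType) (P : I -> R -> Prop) :
  (forall i, exists2 d, 0 < d & forall t, 0 < t <= d -> P i t) ->
  exists2 d, 0 < d & forall t, 0 < t <= d -> forall i, P i t.
Proof.
move=> nearP.
have {}nearP i : exists d : R, 0 < d /\ forall t, 0 < t <= d -> P i t.
  by have [d] := nearP i; exists d.
have [d dP] := boolp.choice nearP.
(* The default 1 covers an empty index type. *)
exists (\big[Order.min/1]_i d i) => [|t /andP[t0 td] i].
  by apply: lt_bigmin => // i _; case: (dP i).
by apply: (dP i).2; rewrite t0 (le_trans td) // bigmin_le_cond.
Qed.

Section TightCut.
Variables (R : realType) (G : multigraph) (D : orientation G).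
Variables (l u f : edge G -> R).
Hypothesis lf : forall e, l e <= f e.
Hypothesis fu : forall e, f e <= u e.
Hypothesis lu : forall e, l e < u e.
Hypothesis f0 : forall v, boundary D f v = 0.

(* The directions in which f can be moved without leaving the bounds. *)
Let feasible (z : edge G -> R) :=
  forall e, (f e = u e -> z e <= 0) /\ (f e = l e -> 0 <= z e).

(** The residual graph of network flow theory: forward arcs can be raised, backward arcs lowered. *)
Let residual a b :=
  [exists e, [&& tail D e == a, head D e == b & f e < u e]
          || [&& head D e == a, tail D e == b & l e < f e]].

Let residual_direction a b : connect residual a b ->
  exists2 z, feasible z & forall v, boundary D z v = (a == v)%:R - (b == v)%:R.
Proof.
apply: connect_boundary.
- by [].
- move=> y z fy fz e; have [y1 y2] := fy e; have [z1 z2] := fz e.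
  split=> fe; last by rewrite addr_ge0 ?y2 ?z2.
  by have := y1 fe; have := z1 fe; lra.
- move=> {}a {}b /existsP[e /orP[]] /and3P[/eqP <- /eqP <- fe].
    exists (fun e' => (e' == e)%:R) => [e'|v]; last exact: boundary_edge.
    split=> // fe'; case: eqP => // ee'.
    by move: fe; rewrite -ee' fe' ltxx.
  exists (fun e' => (-1) * (e' == e)%:R) => [e'|v]; last first.
    by rewrite boundaryZ boundary_edge mulN1r opprB.
  split=> fe'; first by rewrite mulN1r oppr_le0.
  case: eqP => [ee'|]; last by rewrite mulr0.
  by move: fe; rewrite -ee' fe' ltxx.
Qed.

(** If a residual path joins the tail of each saturated edge to its head, a small move along the sum
    of the resulting cycles lowers all saturated edges. Otherwise the vertices reachable from some
    tail form a tight cut, as no residual arc leaves them. *)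
Lemma circulation_lt_or_tight_cut :
  (exists2 g, forall e, l e <= g e < u e & forall v, boundary D g v = 0) \/
  (exists2 X : {set vertex G},
     exists e0, (tail D e0 \in X) && (head D e0 \notin X) &
     (forall e, (tail D e \in X) && (head D e \notin X) -> f e = u e) /\
     (forall e, (tail D e \notin X) && (head D e \in X) -> f e = l e)).
Proof.
have [/forallP conn|] := boolP
    [forall e, (f e == u e) ==> connect residual (tail D e) (head D e)];
  last first.
  rewrite negb_forall => /existsP[e0]; rewrite negb_imply => /andP[_ nc].
  right; exists [set v | connect residual (tail D e0) v]%SET.
    by exists e0; rewrite !inE connect0.
  split=> e; rewrite !inE => /andP[]; last first.
    move=> nt ch; apply/eqP; rewrite eq_le lf andbT leNgt; apply/negP => le.
    case/negP: nt; apply: (connect_trans ch); apply: connect1.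
    by apply/existsP; exists e; rewrite !eqxx le orbT.
  move=> ct nh; apply/eqP; rewrite eq_le fu leNgt; apply/negP => le.
  case/negP: nh; apply: (connect_trans ct); apply: connect1.
  by apply/existsP; exists e; rewrite !eqxx le.
left.
have ex_dir e0 : exists z, [/\ feasible z, f e0 = u e0 -> z e0 < 0
    & forall v, boundary D z v = 0].
  have [fe0|fe0] := eqVneq (f e0) (u e0); last first.
    by exists (fun=> 0); split=> [//||v]; [move/eqP: fe0 | rewrite boundary0].
  have := conn e0; rewrite fe0 eqxx /= => /residual_direction[z zf bz].
  (* Closing the path by [e0] backwards gives a circulation. Lowering [e0] is feasible, since
     [l e0 < u e0 = f e0]. *)
  exists (fun e => z e + (-1) * (e == e0)%:R); split.
  - move=> e; have [z1 z2] := zf e; case: eqP => [->|_]; last first.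
      by rewrite mulr0 addr0.
    split=> [_|fl]; last by have := lu e0; rewrite -fl fe0 ltxx.
    by have := (zf e0).1 fe0; rewrite mulr1; lra.
  - by move=> _; have := (zf e0).1 fe0; rewrite eqxx mulr1; lra.
  - by move=> v; rewrite boundaryD boundaryZ boundary_edge bz mulN1r subrr.
have [c cP] := boolp.choice ex_dir; pose z e := \sum_e0 c e0 e.
have zf : feasible z.
  by move=> e; rewrite /z; split=> fe; [apply: sumr_le0 | apply: sumr_ge0]
    => e0 _;    have [/(_ e)[z1 z2] _ _] := cP e0; auto.
have z_lt0 e : f e = u e -> z e < 0.
  move=> fe; rewrite /z (bigD1 e) //=; have [_ /(_ fe) ce _] := cP e.
  rewrite -[ltRHS]addr0 ltr_leD //; apply: sumr_le0 => e0 _.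
  by have [/(_ e)[z1 z2] _ _] := cP e0; auto.
have [|d d0 dP] := @near0_forall R _ (fun e t => l e <= f e + t * z e < u e).
  move=> e; have [z0|z0|z0] := ltrgtP (z e) 0.
  - have lfe : l e < f e.
      rewrite lt_neqAle lf andbT; apply: contraTneq z0 => /esym/(zf e).2.
      by rewrite leNgt.
    exists ((f e - l e) / - z e); first by rewrite divr_gt0 ?subr_gt0 ?oppr_gt0.
    move=> t /andP[t0]; rewrite ler_pdivlMr ?oppr_gt0 // mulrN => td.
    have : t * z e < 0 by rewrite pmulr_rlt0.
    by have := fu e; lra.
  - have fue : f e < u e.
      rewrite lt_neqAle fu andbT; apply: contraTneq z0 => /(zf e).1.
      by rewrite leNgt.
    (* Half of the gap keeps the upper bound strict. *)
    exists ((u e - f e) / 2 / z e); first by rewrite !divr_gt0 ?subr_gt0.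
    move=> t /andP[t0]; rewrite ler_pdivlMr // => td.
    have : 0 < t * z e by rewrite mulr_gt0.
    by have := lf e; lra.
  - exists 1 => // t _; rewrite z0 mulr0 addr0 lf /= lt_neqAle fu andbT.
    by apply/eqP => /z_lt0; rewrite z0 ltxx.
exists (fun e => f e + d * z e) => [e|v]; first by apply: dP; rewrite d0 lexx.
rewrite boundaryD boundaryZ f0 boundary_sum big1 ?mulr0 ?addr0 // => e _.
by case: (cP e).
Qed.

End TightCut.

(** * The minimal radius *)

Section Radius.
Variables (R : realType) (G : multigraph) (sigma : edge G -> sign).

(* The interval of admissible values containing the value of an edge of sign s
   is [r * lowA / 2 + lowB, r * upA / 2 - upB]; for a negative edge, b tells
   whether it is the upper one of the two intervals. *)
Definition upA (s : sign) (b : bool) : nat :=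
  match s with Pos => 2 | Neg => if b then 2 else 1 end.
Definition upB (s : sign) (b : bool) : nat :=
  match s with Pos => 1 | Neg => ~~ b end.
Definition lowA (s : sign) (b : bool) : nat :=
  match s with Pos => 0 | Neg => b end.
Definition lowB (s : sign) (b : bool) : nat :=
  match s with Pos => 1 | Neg => b end.

Definition upper s b (r : R) : R := r * (upA s b)%:R / 2 - (upB s b)%:R.
Definition lower s b (r : R) : R := r * (lowA s b)%:R / 2 + (lowB s b)%:R.

Lemma closed_valueP s (r x : R) :
  closed_value s r x <-> exists b, lower s b r <= x <= upper s b r.
Proof.
rewrite /upper /lower; case: s => /=.
  by split=> [?|[b]]; [exists true | ]; lra.
split=> [[?|?]|[[] /= ?]];
  [exists false | exists true | right | left] => /=; lra.
Qed.

Lemma lower_lt_upper s b (r : R) : 2 < r -> lower s b r < upper s b r.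
Proof. by rewrite /upper /lower; case: s; case: b => /=; lra. Qed.

Lemma lower_homo s b (r r' : R) : r' <= r -> lower s b r' <= lower s b r.
Proof. by rewrite /lower; case: s; case: b => /=; lra. Qed.

(** The slope of an upper bound in [r] is at most 1. *)
Lemma upper_sub s b (r t : R) : 0 <= t -> upper s b r - t <= upper s b (r - t).
Proof. by rewrite /upper; case: s; case: b => /=; lra. Qed.

(* The tight cut equates the sum of upper bounds over its out-edges with the
   sum of lower bounds over its in-edges, a linear equation in r. *)
Lemma tight_cut_fraction (k : edge G -> bool) (A B : pred (edge G)) e0 (r : R) :
  2 <= r -> A e0 -> (forall e, A e -> ~~ B e) ->
  \sum_(e | A e) upper (sigma e) (k e) r
    = \sum_(e | B e) lower (sigma e) (k e) r ->
  exists p q : int, [/\ 1 <= 2 * q, 2 * q <= p, p <= 2 * #|edge G|%:Z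
    & r = p%:~R / q%:~R].
Proof.
move=> r2 Ae0 AB; rewrite /upper /lower sumrB big_split /=.
rewrite -!mulr_suml -!mulr_sumr -!natr_sum.
set N1 := (\sum_(e | A e) upA _ _)%N; set N2 := (\sum_(e | B e) lowA _ _)%N.
set M1 := (\sum_(e | A e) upB _ _)%N; set M2 := (\sum_(e | B e) lowB _ _)%N.
move=> Er; have {}Er : r * (N1%:R - N2%:R) = 2 * (M1 + M2)%:R.
  by rewrite natrD; lra.
(* Each edge lies in at most one of [A] and [B] and contributes at most 1. *)
have leM : (M1 + M2 <= #|edge G|)%N.
  rewrite /M1 /M2 [X in (X + _ <= _)%N]big_mkcond
    [X in (_ + X <= _)%N]big_mkcond.
  rewrite -big_split -sum1_card /=; apply: leq_sum => e _.
  case: ifP => [/AB/negPf->|_]; first by case: (sigma e); case: (k e).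
  by case: ifP => // _; case: (sigma e); case: (k e).
(* Since [lowA <= lowB], a zero right side would force [N2 = 0] and [r * N1 = 0], while [e0] makes
   [N1] positive. *)
have M_gt0 : (0 < M1 + M2)%N.
  rewrite lt0n; apply/negP => /eqP M0; move: Er; rewrite M0 mulr0 => /eqP.
  have -> : N2 = 0%N.
    have : (N2 <= M2)%N.
      by apply: leq_sum => e _; case: (sigma e); case: (k e).
    by move: M0; case: (M2) => [_|m]; [rewrite leqn0 => /eqP | rewrite addnS].
  apply/negP; rewrite subr0 mulf_neq0 ?gt_eqF //; first by lra.
  rewrite ltr0n /N1 (bigD1 e0) //= addn_gt0.
  by case: (sigma e0); case: (k e0).
have q_gt0 : 0 < N1%:R - N2%:R :> R.
  rewrite -(pmulr_rgt0 _ (_ : 0 < r)) ?Er; last by lra.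
  by rewrite mulr_gt0 ?ltr0n.
exists (2 * (M1 + M2)%:Z), (N1%:Z - N2%:Z).
have qE : (N1%:Z - N2%:Z)%:~R = N1%:R - N2%:R :> R.
  by rewrite intrB.
have pE : (2 * (M1 + M2)%:Z)%:~R = 2 * (M1 + M2)%:R :> R by rewrite intrM.
split; last by rewrite qE pE -Er mulfK // gt_eqF.
- have : (0 < N1%:Z - N2%:Z) by rewrite -(ltr0z R) qE.
  by rewrite gtz0_ge1; lra.
- rewrite -(ler_int R) pE -Er intrM qE ler_pM2r //.
- by rewrite ler_pM2l // lez_nat.
Qed.

(** A circulation strictly below its upper bounds survives a small decrease of [r]: lower bounds do
    not rise and upper bounds fall slowly. Minimality thus leaves only the tight cut. *)
Lemma minimal_radius_fraction (r : R) D f :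
  (0 < #|edge G|)%N -> 2 <= r -> closed_flow sigma r D f ->
  (forall r' D' f', 2 <= r' -> closed_flow sigma r' D' f' -> r <= r') ->
  exists p q : int, [/\ 1 <= 2 * q, 2 * q <= p, p <= 2 * #|edge G|%:Z
    & r = p%:~R / q%:~R].
Proof.
move=> E0 r2 [fv f0] rmin; have [{}r2|r_le2] := ltP 2 r; last first.
  (* At [r = 2] the fraction 2/1 serves; its numerator is allowed because an edge exists. *)
  exists 2, 1; split=> //; first by rewrite ler_pMr // lez_nat.
  by apply/eqP; rewrite divr1 eq_le r_le2 r2.
have [D' bD'] := boundary_norm D f; pose g e := `|f e|.
have [k kP] :=
  boolp.choice (fun e => (closed_valueP (sigma e) r (g e)).1 (fv e)).
pose l e := lower (sigma e) (k e) r; pose u e := upper (sigma e) (k e) r.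
have lg e : l e <= g e by case/andP: (kP e).
have gu e : g e <= u e by case/andP: (kP e).
have lu e : l e < u e by apply: lower_lt_upper.
have g0 v : boundary D' g v = 0 by rewrite bD'.
have [[h hlu h0]|[X [e0 e0X] [outX inX]]] :=
  circulation_lt_or_tight_cut lg gu lu g0.
  have [|d d0 dP] := @near0_forall R _
      (fun e t => h e <= upper (sigma e) (k e) (r - t)).
    move=> e; have /andP[_ hu] := hlu e.
    exists (u e - h e) => [|t /andP[t0 td]]; first by rewrite subr_gt0.
    by apply: le_trans (upper_sub _ _ _ (ltW t0)); rewrite -/(u e); lra.
  (* The cap [r - 2] keeps the new radius at least 2. *)
  pose t := Num.min d (r - 2).
  have t0 : 0 < t by rewrite lt_min d0 subr_gt0.
  have [td tr] : t <= d /\ t <= r - 2 by rewrite !ge_min !lexx orbT.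
  have : r <= r - t; last by lra.
  apply: (rmin _ D' h); first by lra.
  split=> // e; have /andP[lh _] := hlu e.
  have rt : r - t <= r by lra.
  have lh' : lower (sigma e) (k e) (r - t) <= h e.
    exact: le_trans (lower_homo _ _ rt) lh.
  have h_ge0 : 0 <= h e.
    apply: le_trans lh'; rewrite /lower addr_ge0 ?ler0n //.
    by rewrite divr_ge0 // mulr_ge0 ?ler0n //; lra.
  rewrite ger0_norm //; apply/closed_valueP; exists (k e).
  by rewrite lh' dP // t0.
apply: (@tight_cut_fraction k
  (fun e => (tail D' e \in X) && (head D' e \notin X))
  (fun e => (tail D' e \notin X) && (head D' e \in X)) e0 r (ltW r2)) => //.
  by move=> e /andP[-> _].
have := circulation_cut X g0.
by rewrite (eq_bigr u outX) (eq_bigr l inX).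
Qed.

End Radius.

(** * The flow index as an attained minimum *)

Lemma circular_flow_index_attained (R : realType) (G : multigraph)
    (sigma : edge G -> sign) :
  (forall e, ~ positive_bridge sigma e) ->
  exists D f, [/\ closed_flow sigma (circular_flow_index R sigma) D f,
    forall r' D' f', 2 <= r' -> closed_flow sigma r' D' f' ->
      circular_flow_index R sigma <= r'
    & admits_circular_flow sigma (circular_flow_index R sigma)].
Proof.
move=> npb; have [D _] := orientation_exists G.
have [r [f [r2 fP rmin]]] := minimal_closed_flow (closed_flow_exists R D npb).
have {}rmin r' D' f' : 2 <= r' -> closed_flow sigma r' D' f' -> r <= r'.
  by move=> r'2 /(closed_flow_reorient D)[g]; apply: rmin.
have rP : admits_circular_flow sigma r.
  by split=> //; apply: circular_flow_of_closed fP.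
(* Circular flows are closed flows, so the smallest closed radius bounds them all from below; it
   also carries a circular flow, hence is the infimum. *)
have rlb : lbound (fun r => admits_circular_flow sigma r) r.
  by move=> r' [r'2 [D' [f' /circular_flow_closed]]]; apply: rmin.
suff -> : circular_flow_index R sigma = r by exists D, f.
apply/eqP; rewrite eq_le lb_le_inf //; last by exists r.
by rewrite andbT ge_inf //; exists r.
Qed.

Theorem theorem3p9 (R : realType) (G : multigraph) (sigma : edge G -> sign)
    (no_positive_bridge : forall e : edge G, ~ positive_bridge sigma e) :
  ((0 < #|edge G|)%N ->
     is_minimum (bounded_flow_fractions R sigma) (circular_flow_index R sigma))
  /\ (exists x : rat, circular_flow_index R sigma = ratr x).
Proof.
have [D [f [fP rmin rP]]] := circular_flow_index_attained R no_positive_bridge.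
have r2 := rP.1; have [E0|E0] := posnP #|edge G|.
  split; first by [].
  (* Without edges the value conditions are vacuous at radius 2, so the index is 2. *)
  exists 2%:R; rewrite ratr_nat; apply/eqP; rewrite eq_le r2 andbT.
  apply: (rmin _ D f) => //; split=> [e|]; last exact: fP.2.
  by have := fintype0 e E0.
have [p [q [q1 qp pE rE]]] := minimal_radius_fraction E0 r2 fP rmin.
split=> [_|]; last first.
  by exists (p%:~R / q%:~R); rewrite rE fmorph_div /= !ratr_int.
split; first by exists p, q; rewrite -rE.
move=> r [p' [q' [_ _ _ -> [r'2 [D' [f' /circular_flow_closed]]]]]].
by apply: rmin.
Qed.
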